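(* Consider the repair MDP described in the context. Let $\theta$ be a stationary policy, and let $$\tilde g_\theta(\mathbf{x}):=\liminf_{t\to\infty}t^{-1}\mathbb{E}_\theta\Big[\sum_{n=0}^{t-1}\tilde c(\mathbf{x}_n,\theta(\mathbf{x}_n))\,\Big|\,\mathbf{x}_0=\mathbf{x}\Big],\qquad \mathbf{x}\in S,$$ where $\mathbf{x}_n$ is the system state at time step $n$ and, for $\mathbf{x}=(i,(x_1,\dots,x_m))\in S$ and $a\in A_{\mathbf{x}}$, $$\tilde c(\mathbf{x},a)=\begin{cases}\displaystyle\sum_{j\in M}f_j(K_j)-\frac{\mu_i}{\lambda_i}\,[f_i(K_i)-f_i(x_i-1)],&\text{if } i\in M,\ x_i\ge 1\text{ and }a=i,\\[2mm] \displaystyle\sum_{j\in M}f_j(K_j),&\text{otherwise.}\end{cases}$$ Then $\tilde g_\theta(\mathbf{x})=g_\theta(\mathbf{x})$ for all $\mathbf{x}\in S$, where $g_\theta(\mathbf{x})$ is the long-run average cost under the original cost function $c$.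
   Context: Repair MDP. Let $G=(V,E)$ be a finite connected graph, $M\subseteq V$ a set of $m\ge 2$ nodes called machines (labelled $1,\dots,m$), and $N=V\setminus M$ the set of intermediate stages. For each machine $j\in M$ there are an integer $K_j\ge 1$, a degradation rate $\lambda_j>0$, a repair rate $\mu_j>0$, and a strictly increasing cost function $f_j:\{0,1,\dots,K_j\}\to\mathbb{R}$ with $f_j(0)=0$. There is a switching rate $\tau>0$. Units of time are scaled so that $\sum_{j\in M}\lambda_j+\max\{\mu_1,\dots,\mu_m,\tau\}=1$ (so rates serve as one-step transition probabilities of the uniformized discrete-time MDP). The state space is $S=\{(i,(x_1,\dots,x_m)) : i\in V,\ x_j\in\{0,1,\dots,K_j\}\text{ for }j\in M\}$, where $i$ is the node occupied by the single repairer and $x_j$ is the condition of machine $j$. For $\mathbf{x}=(i,(x_1,\dots,x_m))$, let $R(\mathbf{x})$ be the set of nodes adjacent to $i$ and let $A_{\mathbf{x}}=\{i\}\cup R(\mathbf{x})$ be the set of actions. For distinct states $\mathbf{x}=(i,(x_1,\dots,x_m))$, $\mathbf{x}'=(i',(x_1',\dots,x_m'))$ in $S$ and $a\in A_{\mathbf{x}}$, the transition probability $p_{\mathbf{x},\mathbf{x}'}(a)$ equals: $\lambda_j$ if $i'=i$, $x_j'=x_j+1$ for some $j\in M$ and $x_l'=x_l$ for $l\ne j$; $\mu_i$ if $i\in M$, $i'=i$, $x_i'=x_i-1$, $x_j'=x_j$ for $j\neq i$, and $a=i$; $\tau$ if $i'\in R(\mathbf{x})$, $x_j'=x_j$ for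 all $j\in M$, and $a=i'$; and $0$ otherwise. Also $p_{\mathbf{x},\mathbf{x}}(a)=1-\sum_{\mathbf{y}\ne\mathbf{x}}p_{\mathbf{x},\mathbf{y}}(a)$. A stationary policy $\theta$ chooses the same action $\theta(\mathbf{x})\in A_{\mathbf{x}}$ every time the system is in state $\mathbf{x}$. The original one-step cost in state $\mathbf{x}$ is $c(\mathbf{x})=\sum_{j\in M}f_j(x_j)$, and $g_\theta(\mathbf{x})=\liminf_{t\to\infty}t^{-1}\mathbb{E}_\theta\big[\sum_{n=0}^{t-1}c(\mathbf{x}_n)\mid\mathbf{x}_0=\mathbf{x}\big]$. *)

(* Defs.v *)
From HB Require Import structures.
From mathcomp Require Import all_boot all_order all_algebra.
From mathcomp Require Import all_classical all_reals all_analysis.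

Set Implicit Arguments.
Unset Strict Implicit.
Unset Printing Implicit Defensive.

Import Order.TTheory GRing.Theory Num.Theory.
Local Open Scope ring_scope.

Record repair_mdp (R : realType) := RepairMDP {
  node : finType;
  adj : rel node;
  adj_sym : symmetric adj;
  adj_irr : irreflexive adj;
  graph_connected : forall u v : node, connect adj u v;
  machines : {set node};
  machines_ge2 : (2 <= #|machines|)%N;
  (* Per-machine data is indexed by the subtype of nodes that are machines. *)
  capacity : {j : node | j \in machines} -> nat;
  capacity_ge1 : forall j, (1 <= capacity j)%N;
  degr_rate : {j : node | j \in machines} -> R;
  degr_rate_gt0 : forall j, 0 < degr_rate j;
  repair_rate : {j : node | j \in machines} -> R;
  repair_rate_gt0 : forall j, 0 < repair_rate j;
  switch_rate : R;
  switch_rate_gt0 : 0 < switch_rate;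
  (* Since [switch_rate] is the base of the iterated maximum, this is
     max {mu_1, ..., mu_m, tau}. *)
  uniformized : \sum_j degr_rate j
                + \big[Num.max/switch_rate]_j repair_rate j = 1;
  cost_fun : forall j, 'I_(capacity j).+1 -> R;
  cost_fun0 : forall j, cost_fun (@ord0 (capacity j)) = 0;
  cost_fun_incr : forall j (k l : 'I_(capacity j).+1),
    (k < l)%N -> cost_fun k < cost_fun l
}.

Section RepairMDP.
Context {R : realType} (D : repair_mdp R).

Definition machine : finType := {j : node D | j \in machines D}.

Definition state : finType :=
  (node D * {dffun forall j : machine, 'I_(capacity j).+1})%type.

Definition neighbours (x : state) : {set node D} := [set v | adj x.1 v].

Definition actions (x : state) : {set node D} := x.1 |: neighbours x.

Definition degrades (x x' : state) (j : machine) : bool :=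
  [&& x'.1 == x.1, x'.2 j == (x.2 j).+1 :> nat
    & [forall (l | l != j), x'.2 l == x.2 l]].

(* [x.2 j == (x'.2 j).+1] says x'_j = x_j - 1 without truncated subtraction. *)
Definition repaired (x x' : state) (a : node D) (j : machine) : bool :=
  [&& x.1 == val j, x'.1 == x.1, x.2 j == (x'.2 j).+1 :> nat,
      [forall (l | l != j), x'.2 l == x.2 l] & a == x.1].

Definition switches (x x' : state) (a : node D) : bool :=
  [&& x'.1 \in neighbours x, [forall j, x'.2 j == x.2 j] & a == x'.1].

(* p_{x,x'}(a) for x != x'; the machine picked, if any, is unique. *)
Definition jump_prob (x : state) (a : node D) (x' : state) : R :=
  if [pick j | degrades x x' j] is Some j then degr_rate j
  else if [pick j | repaired x x' a j] is Some j then repair_rate j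
  else if switches x x' a then switch_rate D
  else 0.

Definition trans_prob (x : state) (a : node D) (x' : state) : R :=
  if x' == x then 1 - \sum_(y | y != x) jump_prob x a y
  else jump_prob x a x'.

Definition stationary_policy (theta : state -> node D) : Prop :=
  forall x, theta x \in actions x.

(* Probability, given x_0 = w_0, that the first t steps of the chain under
   theta follow the trajectory w = (w_0, ..., w_t). *)
Definition path_prob (theta : state -> node D) (t : nat)
    (w : {ffun 'I_t.+1 -> state}) : R :=
  \prod_(n < t)
    trans_prob (w (inord n)) (theta (w (inord n))) (w (inord n.+1)).

(* E_theta [F (x_0, ..., x_t) | x_0 = x] *)
Definition expect_from (theta : state -> node D) (x : state) (t : nat)
    (F : {ffun 'I_t.+1 -> state} -> R) : R :=
  \sum_(w : {ffun 'I_t.+1 -> state} | w ord0 == x) path_prob theta w * F w.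

(* The liminf is taken in \bar R, where it exists for every sequence. The term
   at t = 0 (where t^-1 = 0) does not affect it. *)
Definition average_cost (theta : state -> node D)
    (cost : state -> node D -> R) (x : state) : \bar R :=
  limn_einf (fun t : nat =>
    (t%:R^-1 * expect_from theta x (fun w : {ffun 'I_t.+1 -> state} =>
       \sum_(n < t) cost (w (inord n)) (theta (w (inord n)))))%:E).

Definition orig_cost (x : state) : R := \sum_(j : machine) cost_fun (x.2 j).

Definition max_cost : R :=
  \sum_(j : machine) cost_fun (@ord_max (capacity j)).

Definition alt_cost (x : state) (a : node D) : R :=
  if [pick j : machine | [&& x.1 == val j, (1 <= x.2 j)%N & a == x.1]]
    is Some j
  then max_cost - repair_rate j / degr_rate j
         * (cost_fun (@ord_max (capacity j))
            - cost_fun (inord (x.2 j).-1 : 'I_(capacity j).+1))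
  else max_cost.

Definition g_orig (theta : state -> node D) (x : state) : \bar R :=
  average_cost theta (fun y _ => orig_cost y) x.

Definition g_alt (theta : state -> node D) (x : state) : \bar R :=
  average_cost theta alt_cost x.

End RepairMDP.

(* Main.v *)
Require Import Defs.
From mathcomp Require Import all_boot all_order all_algebra.
From mathcomp Require Import all_classical all_reals all_analysis.
From mathcomp Require Import ring.

Set Implicit Arguments.
Unset Strict Implicit.
Unset Printing Implicit Defensive.

Import Order.TTheory GRing.Theory Num.Theory.
Local Open Scope ring_scope.

(** The two costs differ by the drift of a function of the state. For machine
  [j] put phi_j(k) = sum_(l < k) (f_j(K_j) - f_j(l)) / lambda_j, and let h(x)
  be the sum of the phi_j(x_j) ([potential]). A degradation of machine [j] from
  condition [k] occurs with probability lambda_j and raises h by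
  (f_j(K_j) - f_j(k)) / lambda_j, so degradations contribute
  sum_j (f_j(K_j) - f_j(x_j)) to the expected one-step change of h; a machine
  with x_j = K_j cannot degrade, but then its term is 0. A repair of machine
  [i] contributes - (mu_i / lambda_i) (f_i(K_i) - f_i(x_i - 1)), and a move of
  the repairer leaves h unchanged. Hence, in every state and for every action,
  the expected change of h equals the alternative cost minus the original cost
  ([poisson_equation]).

  Summing this along the chain, the expected total alternative and original
  costs over [t] steps differ by E[h(x_t)] - h(x_0)
  ([expect_total_cost_telescope]). Since the state space is finite, this is
  bounded in [t]. After division by [t] it tends to 0, and two real sequences
  whose difference tends to 0 have the same limit inferior
  ([eq_limn_einf_cvg0]).

  Bounding E[h(x_t)] uses that the chain has genuine transition
  probabilities. Their sum over the next state is 1 by construction, but the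
  probability of staying put is nonnegative only thanks to the scaling of time:
  in one step at most all degradations compete with either one repair or one
  move, never both, so the rates sum to at most
  sum_j lambda_j + max(mu_1, ..., mu_m, tau) = 1 ([sum_jump_prob_le1]). *)

(** * One-step transitions *)

(** Turns the choice operators in the definitions of the jump probabilities and
  of the alternative cost into sums, which can be exchanged and split. *)
Lemma big_pick (T : finType) (V : nmodType) (P : pred T) (F : T -> V) :
  (forall i j, P i -> P j -> i = j) ->
  \sum_(j | P j) F j = if [pick j | P j] is Some j then F j else 0.
Proof.
move=> P_uniq; case: pickP => [j Pj|P0]; last by rewrite big_pred0.
rewrite (bigD1 j)//= big1 ?addr0// => i /andP[Pi /eqP ij].
by case: ij; exact: P_uniq.
Qed.

Section Transitions.
Context {R : realType} (D : repair_mdp R).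
Implicit Types (x y : state D) (a : node D) (j : machine D).

(** The dependent update [dfwith] is needed because the range of conditions
  varies with the machine. *)
Definition set_condition x j (k : 'I_(capacity j).+1) : state D :=
  (x.1, [ffun l : machine D => eqtype.dfwith (fun l => x.2 l) k l]).

Lemma set_conditionE x j k y :
  (y == @set_condition x j k) =
  [&& y.1 == x.1, y.2 j == k & [forall (l | l != j), y.2 l == x.2 l]].
Proof.
apply/eqP/and3P => [->|[/eqP y1 /eqP yj /forall_inP yl]].
  split=> //=; first by rewrite ffunE dfwith_in.
  by apply/forall_inP => l lj; rewrite ffunE dfwith_out// eq_sym.
rewrite (surjective_pairing y) y1; congr pair.
apply/ffunP => l; rewrite ffunE; have [jl|lj] := eqVneq l j.
  by subst l; rewrite dfwith_in.
by rewrite dfwith_out ?(eqP (yl _ lj))// eq_sym.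
Qed.

Definition can_degrade x j := (x.2 j < capacity j)%N.
Definition can_repair x a j := [&& x.1 == val j, (1 <= x.2 j)%N & a == x.1].
Definition degraded x j := set_condition x (inord (x.2 j).+1 : 'I_(capacity j).+1).
Definition restored x j := set_condition x (inord (x.2 j).-1 : 'I_(capacity j).+1).

Lemma degradesE x y j : degrades x y j = can_degrade x j && (y == degraded x j).
Proof.
rewrite /degrades /degraded set_conditionE /can_degrade.
rewrite [y.2 j == inord _]/eq_op/=.
have [xj|xj] := ltnP; first by rewrite inordK.
apply/and3P => -[_ /eqP yj _].
by move: (ltn_ord (y.2 j)); rewrite yj !ltnS ltnNge xj.
Qed.

Lemma repairedE x y a j : repaired x y a j = can_repair x a j && (y == restored x j).
Proof.
rewrite /repaired /restored set_conditionE /can_repair.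
rewrite [y.2 j == inord _]/eq_op/=.
case: (x.1 == val j) => //=; rewrite andbC -!andbA.
rewrite inordK; last by rewrite (leq_ltn_trans (leq_pred _)).
case: (x.2 j : nat) => [|n]/=; rewrite ?andbF//.
rewrite eqSS eq_sym [_ == n]eq_sym.
by case: (n == _); case: (a == _); case: (y.1 == _); rewrite /= ?andbT ?andbF.
Qed.

Lemma switchesE x y a : switches x y a = adj x.1 a && (y == (a, x.2)).
Proof.
rewrite /switches inE; apply/and3P/andP => [[xy /forallP y2 /eqP ->]|].
  split => //; rewrite {1}(surjective_pairing y) xpair_eqE eqxx/=.
  by apply/eqP/ffunP => l; exact/eqP.
by move=> [xa /eqP ->]/=; split => //; apply/forallP.
Qed.

Lemma degrades_uniq x y i j : degrades x y i -> degrades x y j -> i = j.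
Proof.
move=> /and3P[_ /eqP yi _] /and3P[_ _ /forall_inP/(_ i) yl].
have [//|ij] := eqVneq i j.
by move: (yl ij) yi => /eqP -> /n_Sn.
Qed.

Lemma can_repair_uniq x a i j : can_repair x a i -> can_repair x a j -> i = j.
Proof.
by move=> /and3P[/eqP xi _ _] /and3P[/eqP xj _ _]; apply: val_inj; rewrite -xi.
Qed.

Lemma repaired_uniq x y a i j : repaired x y a i -> repaired x y a j -> i = j.
Proof. by rewrite !repairedE => /andP[xi _] /andP[/(can_repair_uniq xi)]. Qed.

Lemma degrades_not_repaired x y a i j : degrades x y i -> repaired x y a j -> False.
Proof.
move=> /and3P[_ /eqP yi _] /and5P[_ _ /eqP xj /forall_inP xl _].
have [ij|ij] := eqVneq i j.
  subst i; have : (x.2 j < y.2 j)%N by rewrite yi.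
  by rewrite ltnNge xj leqnSn.
by move: (xl _ ij) yi => /eqP -> /n_Sn.
Qed.

(** The possible transitions are mutually exclusive, so the case distinction
  defining a jump probability is a sum of indicator functions. *)
Lemma jump_probE x a y :
  jump_prob x a y = \sum_(j | degrades x y j) degr_rate j
                  + \sum_(j | repaired x y a j) repair_rate j
                  + switch_rate D *+ switches x y a.
Proof.
rewrite !big_pick/=; [|exact: repaired_uniq|exact: degrades_uniq].
have switch_moves : y.1 == x.1 -> switches x y a = false.
  by move=> /eqP yx; apply/negP => /and3P[]; rewrite inE yx adj_irr.
rewrite /jump_prob; case: pickP => [i di|d0].
  case: pickP => [j rj|_]; first by have := degrades_not_repaired di rj.
  by case/and3P: di => /switch_moves -> _ _; rewrite mulr0n !addr0.
case: pickP => [j /and5P[_ /switch_moves -> _ _ _]|_].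
  by rewrite mulr0n add0r addr0.
by rewrite !add0r; case: ifP.
Qed.

Lemma jump_prob_ge0 x a y : 0 <= jump_prob x a y.
Proof.
rewrite jump_probE !addr_ge0 ?mulrn_wge0 ?sumr_ge0// => *; apply: ltW.
- exact: degr_rate_gt0.
- exact: repair_rate_gt0.
- exact: switch_rate_gt0.
Qed.

(** The restriction to distinct states is therefore harmless: sums of jump
  probabilities may range over all states. *)
Lemma jump_prob_diag x a : jump_prob x a x = 0.
Proof.
rewrite jump_probE switchesE.
have S (n : nat) : (n == n.+1) = false by rewrite ltn_eqF.
rewrite !big_pred0 ?add0r; last 2 first.
- by move=> j; rewrite /repaired S !andbF.
- by move=> j; rewrite /degrades S !andbF.
have [/andP[]|//] := boolP (_ && _).
by move=> xa /eqP xE; move: xa; rewrite {1}xE/= adj_irr.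
Qed.

(** Each kind of transition has a single target, so a sum over next states
  becomes a sum over the transitions available in [x]. *)
Lemma sum_jump_prob x a (G : state D -> R) :
  \sum_y jump_prob x a y * G y =
    \sum_(j | can_degrade x j) degr_rate j * G (degraded x j)
  + \sum_(j | can_repair x a j) repair_rate j * G (restored x j)
  + switch_rate D * G (a, x.2) *+ adj x.1 a.
Proof.
have marg (b : bool) z (r : R) : \sum_y (if b && (y == z) then r * G y else 0) =
    if b then r * G z else 0.
  by rewrite -big_mkcond; case: b => /=; rewrite ?big_pred1_eq ?big_pred0_eq.
under eq_bigr do rewrite jump_probE !mulrDl !mulr_suml.
rewrite !big_split/=; congr (_ + _ + _).
- under eq_bigr do rewrite big_mkcond.
  rewrite exchange_big/= [RHS]big_mkcond; apply: eq_bigr => j _.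
  by under eq_bigr do rewrite degradesE; exact: marg.
- under eq_bigr do rewrite big_mkcond.
  rewrite exchange_big/= [RHS]big_mkcond; apply: eq_bigr => j _.
  by under eq_bigr do rewrite repairedE; exact: marg.
- under eq_bigr do rewrite switchesE mulrb (fun_if ( *%R^~ _)) mul0r.
  by rewrite marg mulrb.
Qed.

(** The one place where the scaling of time enters. A repair requires the
  repairer to stay and a move requires leaving along an edge, and the graph has
  no loops; so the two never compete, and the maximum of their rates suffices
  to bound what comes on top of the degradations. *)
Lemma sum_jump_prob_le1 x a : \sum_y jump_prob x a y <= 1.
Proof.
have -> : \sum_y jump_prob x a y = \sum_(j | can_degrade x j) degr_rate j
    + (\sum_(j | can_repair x a j) repair_rate j + switch_rate D *+ adj x.1 a).
  have := sum_jump_prob x a (fun=> 1); rewrite -addrA mulr1.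
  by rewrite -!mulr_suml !mulr1.
rewrite -(uniformized D); apply: lerD.
  rewrite big_mkcond; apply: ler_sum => j _.
  by case: ifP => // _; rewrite ltW// degr_rate_gt0.
set mx := \big[_/_]_j _.
have tau_mx : switch_rate D <= mx by exact: bigmax_ge_id.
have mx_ge0 : 0 <= mx by rewrite (le_trans _ tau_mx)// ltW// switch_rate_gt0.
have [->|ax] := eqVneq a x.1.
  rewrite adj_irr mulr0n addr0 big_pick; last exact: can_repair_uniq.
  by case: pickP => // j _; exact: le_bigmax.
rewrite big_pred0 ?add0r; last by move=> j; rewrite /can_repair (negbTE ax) !andbF.
by case: adj.
Qed.

Lemma trans_probE x a y :
  trans_prob x a y
  = jump_prob x a y + (1 - \sum_z jump_prob x a z) *+ (y == x).
Proof.
rewrite /trans_prob; case: eqP => [->|_]; last by rewrite addr0.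
by rewrite [in RHS](bigD1 x)//= jump_prob_diag !add0r.
Qed.

Lemma trans_prob_ge0 x a y : 0 <= trans_prob x a y.
Proof.
by rewrite trans_probE addr_ge0 ?jump_prob_ge0 ?mulrn_wge0 ?subr_ge0 ?sum_jump_prob_le1.
Qed.

(** The mass left at [x] makes the transition probabilities sum to 1, so only
  the increments of [G] count. *)
Lemma sum_trans_prob x a (G : state D -> R) :
  \sum_y trans_prob x a y * G y = G x + \sum_y jump_prob x a y * (G y - G x).
Proof.
under eq_bigr do rewrite trans_probE mulrDl mulrnAl mulrb.
rewrite big_split/= -big_mkcond big_pred1_eq.
under [in RHS]eq_bigr do rewrite mulrBr.
by rewrite sumrB -mulr_suml; ring.
Qed.

Lemma sum_trans_prob1 x a : \sum_y trans_prob x a y = 1.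
Proof.
have := sum_trans_prob x a (fun=> 1); under eq_bigr do rewrite mulr1.
by move=> ->; rewrite big1 ?addr0// => y _; rewrite subrr mulr0.
Qed.

(** * The potential and its Poisson equation *)

(** The increments are forced by requiring that a degradation from condition
  [l], which has rate lambda_j, contribute f_j(K_j) - f_j(l) to the drift. *)
Definition machine_potential j (k : nat) : R :=
  \sum_(0 <= l < k)
    (cost_fun (@ord_max (capacity j)) - cost_fun (inord l : 'I_(capacity j).+1))
    / degr_rate j.

Definition potential x : R := \sum_j machine_potential j (x.2 j).

Lemma potential_set_condition x j k :
  potential (@set_condition x j k) - potential x
  = machine_potential j k - machine_potential j (x.2 j).
Proof.
rewrite /potential -sumrB (bigD1 j)//= ffunE dfwith_in.
rewrite big1 ?addr0// => l lj.
by rewrite ffunE dfwith_out ?subrr// eq_sym.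
Qed.

Lemma alt_costE x a :
  alt_cost x a = max_cost D - \sum_(j | can_repair x a j)
    repair_rate j / degr_rate j * (cost_fun (@ord_max (capacity j))
      - cost_fun (inord (x.2 j).-1 : 'I_(capacity j).+1)).
Proof.
rewrite big_pick; last exact: can_repair_uniq.
by rewrite /alt_cost; case: pickP => //; rewrite subr0.
Qed.

(** Degradations turn the original cost into [max_cost], and the repair in
  progress subtracts exactly the reward in the alternative cost. *)
Lemma poisson_equation x a :
  \sum_y trans_prob x a y * potential y
  = potential x + (alt_cost x a - orig_cost x).
Proof.
rewrite sum_trans_prob; congr (_ + _).
rewrite (sum_jump_prob x a (fun y => potential y - potential x)) alt_costE.
rewrite [potential (a, x.2) - _]subrr mulr0 mul0rn addr0 addrAC; congr (_ + _).
  rewrite /max_cost /orig_cost -sumrB big_mkcond/=; apply: eq_bigr => j _.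
  case: ifPn => [xj|].
    rewrite potential_set_condition inordK// /machine_potential.
    rewrite big_nat_recr//= addrAC subrr add0r inord_val mulrC divfK//.
    by rewrite gt_eqF// degr_rate_gt0.
  (* A machine in its worst condition cannot degrade, and f_j(K_j) - f_j(x_j)
     vanishes. *)
  rewrite -leqNgt => xj.
  suff -> : x.2 j = ord_max by rewrite subrr.
  by apply/val_inj/eqP; rewrite eqn_leq xj -ltnS ltn_ord.
rewrite -[RHS]sumrN; apply: eq_bigr => j /and3P[_ xj _].
rewrite potential_set_condition inordK; last by rewrite (leq_ltn_trans (leq_pred _)).
rewrite /machine_potential; case: (x.2 j : nat) xj => // n _ /=.
by rewrite big_nat_recr//= opprD addrA subrr add0r; ring.
Qed.

End Transitions.
(** * Limit inferior of asymptotically equal sequences *)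

Section LimInf.
Context {R : realType}.
Local Open Scope classical_set_scope.
Local Open Scope ereal_scope.

Lemma le_limn_einf_near (u v : (\bar R)^nat) :
  (\forall n \near \oo, u n <= v n) -> limn_einf u <= limn_einf v.
Proof.
move=> [N _ uv]; rewrite !limn_einf_lim.
apply: lee_lim; [exact: is_cvg_einfs|exact: is_cvg_einfs|].
exists N => // n /= Nn; apply: le_ereal_inf_tmp => _ [k /= nk <-].
apply: (le_trans _ (uv k _)); last exact: leq_trans nk.
by apply: ereal_inf_lbound; exists k.
Qed.

(** If [a <= e + b] eventually, then the limit inferior of [a] exceeds that of [b]
  by at most [e]; this holds for every [e > 0] and in both directions. *)
Lemma eq_limn_einf_cvg0 (u v : nat -> R) :
  ((u n - v n)%R @[n --> \oo] --> 0%R) ->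
  limn_einf (fun n => (u n)%:E) = limn_einf (fun n => (v n)%:E).
Proof.
move=> uv0.
suff le (a b : nat -> R) : ((a n - b n)%R @[n --> \oo] --> 0%R) ->
    limn_einf (fun n => (a n)%:E) <= limn_einf (fun n => (b n)%:E).
  apply/eqP; rewrite eq_le !le//.
  rewrite -oppr0; under eq_fun do rewrite -opprB.
  exact: cvgN.
move=> /cvgrPdist_le ab0; apply/lee_addgt0Pr => e e0.
rewrite addeC -limn_einf_shift//; apply: le_limn_einf_near.
have := ab0 _ e0; apply: filterS => n /=.
rewrite sub0r normrN => /ler_normlP[_ abe].
by rewrite -EFinD lee_fin -lerBlDr.
Qed.
End LimInf.

(** * Expectations along trajectories *)

Section Trajectories.
Context {R : realType} (D : repair_mdp R) (theta : state D -> node D).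
Notation traj t := {ffun 'I_t.+1 -> state D}.

Definition extend t (w : traj t) (y : state D) : traj t.+1 :=
  [ffun i : 'I_t.+2 => if (i < t.+1)%N then w (inord i) else y].

Lemma extend_old t (w : traj t) y n : (n <= t)%N ->
  extend w y (inord n) = w (inord n).
Proof. by move=> nt; rewrite ffunE inordK ltnS ?nt// leqW. Qed.

Lemma extend_last t (w : traj t) y : extend w y (inord t.+1) = y.
Proof. by rewrite ffunE inordK ?ltnn. Qed.

Lemma path_prob_extend t (w : traj t) y :
  path_prob theta (extend w y)
  = path_prob theta w
    * trans_prob (w (inord t)) (theta (w (inord t))) y.
Proof.
rewrite /path_prob big_ord_recr/= extend_last extend_old//; congr (_ * _).
by apply: eq_bigr => n _; rewrite !extend_old// ltnW.
Qed.

(** Conditioning on all but the last step: the tool for every induction on the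
  horizon below. *)
Lemma expect_from_extend x t (F : traj t.+1 -> R) :
  expect_from theta x F = expect_from theta x (fun w : traj t =>
    \sum_y trans_prob (w (inord t)) (theta (w (inord t))) y * F (extend w y)).
Proof.
rewrite /expect_from.
under [RHS]eq_bigr do rewrite mulr_sumr.
rewrite pair_big_dep/=.
pose restrict (w : traj t.+1) : traj t := [ffun i : 'I_t.+1 => w (inord i)].
rewrite (reindex (fun p : traj t * state D => extend p.1 p.2))/=.
  apply: eq_big => [[w y]|[w y] _]/=; last by rewrite path_prob_extend mulrA.
  by rewrite andbT ffunE/= (_ : inord 0 = ord0)//; apply: val_inj; rewrite /= inordK.
exists (fun w => (restrict w, w (inord t.+1))) => [[w y]|w] _ /=.
  rewrite extend_last; congr pair; apply/ffunP => i.
  by rewrite ffunE extend_old ?inord_val// -ltnS.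
apply/ffunP => i; rewrite ffunE; have [it|ti] := ltnP.
  by rewrite ffunE inordK// inord_val.
congr (w _); apply/val_inj/eqP; rewrite /= inordK// eqn_leq ti.
by rewrite -ltnS ltn_ord.
Qed.

Lemma eq_expect_from x t (F G : traj t -> R) : F =1 G ->
  expect_from theta x F = expect_from theta x G.
Proof. by move=> FG; apply: eq_bigr => w _; rewrite FG. Qed.

Lemma expect_fromD x t (F G : traj t -> R) :
  expect_from theta x (fun w => F w + G w)
  = expect_from theta x F + expect_from theta x G.
Proof. by rewrite /expect_from -big_split; apply: eq_bigr => w _; rewrite mulrDr. Qed.

Lemma expect_fromB x t (F G : traj t -> R) :
  expect_from theta x (fun w => F w - G w)
  = expect_from theta x F - expect_from theta x G.
Proof. by rewrite /expect_from -sumrB; apply: eq_bigr => w _; rewrite mulrBr. Qed.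

Lemma expect_from0 x (F : traj 0 -> R) :
  expect_from theta x F = F [ffun=> x].
Proof.
rewrite /expect_from (big_pred1 [ffun=> x]) => [|w].
  by rewrite /path_prob big_ord0 mul1r.
apply/eqP/eqP => [<-|->]; last by rewrite ffunE.
by apply/ffunP => i; rewrite ffunE ord1.
Qed.

Lemma expect_from_last x t (h : state D -> R) :
  expect_from theta x (fun w : traj t.+1 => h (w (inord t.+1)))
  = expect_from theta x (fun w : traj t =>
      \sum_y trans_prob (w (inord t)) (theta (w (inord t))) y * h y).
Proof.
rewrite expect_from_extend; apply: eq_expect_from => w.
by under eq_bigr do rewrite extend_last.
Qed.

Lemma path_prob_ge0 t (w : traj t) : 0 <= path_prob theta w.
Proof. by apply: prodr_ge0 => n _; exact: trans_prob_ge0. Qed.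

Lemma expect_from_cst x t (c : R) : expect_from theta x (fun _ : traj t => c) = c.
Proof.
elim: t => [|t IH]; first by rewrite expect_from0.
rewrite expect_from_extend -[RHS]IH; apply: eq_expect_from => w.
by rewrite -mulr_suml sum_trans_prob1 mul1r.
Qed.

(** An expectation is an average with nonnegative weights of total mass 1. *)
Lemma norm_expect_from_le x t (F : traj t -> R) (b : R) :
  (forall w, `|F w| <= b) -> `|expect_from theta x F| <= b.
Proof.
move=> Fb; rewrite -[leRHS](expect_from_cst x t).
apply: (le_trans (ler_norm_sum _ _ _)); apply: ler_sum => w _.
by rewrite normrM (ger0_norm (path_prob_ge0 w)) ler_wpM2l// path_prob_ge0.
Qed.

Definition total_cost t (cost : state D -> node D -> R) (w : traj t) : R :=
  \sum_(n < t) cost (w (inord n)) (theta (w (inord n))).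

Lemma expect_total_costS x t cost :
  expect_from theta x (@total_cost t.+1 cost)
  = expect_from theta x (@total_cost t cost)
    + expect_from theta x
        (fun w : traj t => cost (w (inord t)) (theta (w (inord t)))).
Proof.
rewrite expect_from_extend -expect_fromD; apply: eq_expect_from => w.
under eq_bigr => y _.
  rewrite /total_cost big_ord_recr/= extend_old//.
  under eq_bigr => n _ do rewrite extend_old ?(ltnW (ltn_ord n))//.
  over.
by rewrite -mulr_suml sum_trans_prob1 mul1r.
Qed.

(** By the Poisson equation, the step from time [t] to [t + 1] adds the same
  amount to the difference of the total costs as to the expected potential. *)
Lemma expect_total_cost_telescope x t :
  expect_from theta x (@total_cost t (@alt_cost R D))
  - expect_from theta x (@total_cost t (fun y _ => orig_cost y))
  = expect_from theta x (fun w : traj t => potential (w (inord t))) - potential x.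
Proof.
elim: t => [|t IH].
  by rewrite !expect_from0 /total_cost !big_ord0 ffunE !subrr.
rewrite !expect_total_costS expect_from_last.
under [in RHS]eq_expect_from do rewrite poisson_equation.
rewrite expect_fromD expect_fromB.
by move/eqP: IH; rewrite eq_sym subr_eq => /eqP ->; ring.
Qed.

Lemma average_difference_cvg0 x :
  ((t%:R^-1 * expect_from theta x (@total_cost t (@alt_cost R D))
    - t%:R^-1 * expect_from theta x (@total_cost t (fun y _ => orig_cost y)))
   @[t --> \oo] --> 0)%classic.
Proof.
pose b : R := \sum_(y : state D) `|potential y|.
have hb (y : state D) : `|potential y : R| <= b by rewrite /b (bigD1 y)//= lerDl sumr_ge0.
(* Shifting the index replaces the inverse of [t] by the harmonic sequence. *)
rewrite -cvg_shiftS; apply: norm_cvg0.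
apply: (@squeeze_cvgr _ _ _ _ (fun=> 0) (fun n => (b + b) * harmonic n)).
- apply: nearW => n; rewrite normr_ge0/= -mulrBr expect_total_cost_telescope.
  rewrite normrM ger0_norm ?invr_ge0// mulrC ler_wpM2r ?invr_ge0//.
  by rewrite (le_trans (ler_normB _ _))// lerD ?norm_expect_from_le.
- exact: (@cvg_cst R^o).
- have := cvgZl_tmp (k := b + b) (@cvg_harmonic R); rewrite scaler0; exact.
Qed.

End Trajectories.

Theorem proposition4p1 (R : realType) (D : repair_mdp R)
    (theta : state D -> node D) (htheta : stationary_policy theta)
    (x : state D) :
  g_alt theta x = g_orig theta x.
Proof. exact/eq_limn_einf_cvg0/average_difference_cvg0. Qed.
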